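(* Let $R$ be a Rickart $*$-ring. Then each of the two relations ${*{\preceq}}$ and ${{\preceq}*}$ on $R$, defined by \[ a \mathrel{{*}{\preceq}} b \iff a^{\backprime\backprime} b = a = b^{\backprime\backprime} a, \qquad a \mathrel{{\preceq}{*}} b \iff b a'' = a = a b'' \qquad (a,b\in R), \] is a partial order on $R$.
   Context: Rings are associative. A projection of an involution ring is a self-adjoint idempotent ($e=e^*=e^2$). A Rickart $*$-ring is a ring with involution in which the left and the right annihilator of every element is a principal (left, resp. right) ideal generated by a projection; such a ring is unital. Equivalently, for every $x$ there are (necessarily unique) projections $x^{\backprime}$ and $x'$ such that for all $y,z$: $yx=0$ iff $yx^{\backprime}=y$, and $xz=0$ iff $x'z=z$. One writes $x^{\backprime\backprime}=(x^{\backprime})^{\backprime}=1-x^{\backprime}$ and $x''=(x')'=1-x'$. *)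

(* Defs.v *)
From Corelib Require Relation_Definitions.
From HB Require Import structures.
From mathcomp Require Import all_boot all_algebra.
From mathcomp Require Import boolp classical_sets.

Set Implicit Arguments.
Unset Strict Implicit.
Unset Printing Implicit Defensive.

Import GRing.Theory.
Local Open Scope classical_set_scope.
Local Open Scope ring_scope.

(* [pzRingType]: associative, unital, possibly noncommutative, possibly zero *)
HB.mixin Record PzRing_hasInvolution R of GRing.PzRing R := {
  star : R -> R;
  starK : involutive star;
  starD : {morph star : x y / x + y};
  starM : forall x y : R, star (x * y) = star y * star x
}.

#[short(type="involutionRingType")]
HB.structure Definition InvolutionRing :=
  { R of GRing.PzRing R & PzRing_hasInvolution R }.

Definition projection (R : involutionRingType) (e : R) : Prop :=
  e = star e /\ e = e * e.

Definition left_annihilator (R : pzRingType) (x : R) : set R :=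
  [set y | y * x = 0].

Definition right_annihilator (R : pzRingType) (x : R) : set R :=
  [set z | x * z = 0].

Definition principal_left_ideal (R : pzRingType) (e : R) : set R :=
  [set r * e | r in [set: R]].

Definition principal_right_ideal (R : pzRingType) (e : R) : set R :=
  [set e * r | r in [set: R]].

HB.mixin Record InvolutionRing_isRickart R of InvolutionRing R := {
  left_annihilator_ex : forall x : R,
    exists2 e : R, projection e & left_annihilator x = principal_left_ideal e;
  right_annihilator_ex : forall x : R,
    exists2 e : R, projection e & right_annihilator x = principal_right_ideal e
}.

#[short(type="rickartStarRingType")]
HB.structure Definition RickartStarRing :=
  { R of InvolutionRing R & InvolutionRing_isRickart R }.

(* [lproj x] is x^` and [rproj x] is x'; the default value 0 of [xget] is never
   reached, see [lprojP] and [rprojP]. *)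
Definition lproj (R : rickartStarRingType) (x : R) : R :=
  xget 0 [set e | projection e /\ forall y, y * x = 0 <-> y * e = y].

Definition rproj (R : rickartStarRingType) (x : R) : R :=
  xget 0 [set e | projection e /\ forall z, x * z = 0 <-> e * z = z].

Lemma lprojP (R : rickartStarRingType) (x : R) :
  projection (lproj x) /\ forall y, y * x = 0 <-> y * lproj x = y.
Proof.
apply: (@xgetPex _ 0
  [set e | projection e /\ forall y, y * x = 0 <-> y * e = y]).
have [e [es ee] /seteqP[se es']] := left_annihilator_ex x.
exists e; split=> // y; split=> [/se[r _ <-]|<-]; first by rewrite -mulrA -ee.
by apply: es'; exists y.
Qed.

Lemma rprojP (R : rickartStarRingType) (x : R) :
  projection (rproj x) /\ forall z, x * z = 0 <-> rproj x * z = z.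
Proof.
apply: (@xgetPex _ 0
  [set e | projection e /\ forall z, x * z = 0 <-> e * z = z]).
have [e [es ee] /seteqP[se es']] := right_annihilator_ex x.
exists e; split=> // y; split=> [/se[r _ <-]|<-]; first by rewrite mulrA -ee.
by apply: es'; exists y.
Qed.

Lemma lproj_unique (R : rickartStarRingType) (x e : R) :
  projection e -> (forall y, y * x = 0 <-> y * e = y) -> lproj x = e.
Proof.
have [[ls ll] lP] := lprojP x; move=> [es ee] eP.
have le : lproj x * e = lproj x by apply/eP/lP.
have el : e * lproj x = e by apply/lP/eP.
by rewrite -le ls es -starM el.
Qed.

Lemma rproj_unique (R : rickartStarRingType) (x e : R) :
  projection e -> (forall z, x * z = 0 <-> e * z = z) -> rproj x = e.
Proof.
have [[ls ll] lP] := rprojP x; move=> [es ee] eP.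
have le : e * rproj x = rproj x by apply/eP/lP.
have el : rproj x * e = e by apply/lP/eP.
by rewrite -le ls es -starM el.
Qed.

Definition left_star_le (R : rickartStarRingType) (a b : R) : Prop :=
  lproj (lproj a) * b = a /\ a = lproj (lproj b) * a.

Definition right_star_le (R : rickartStarRingType) (a b : R) : Prop :=
  b * rproj (rproj a) = a /\ a = a * rproj (rproj b).

Definition partial_order (T : Type) (le : T -> T -> Prop) : Prop :=
  Relation_Definitions.order T le.

(* Main.v *)
(** Write [p a] for the left support projection of [a], that is, [1 - lproj a].
    Since [y * a = 0] iff [y * p a = 0], an identity [p b * a = a] lifts to
    [p b * p a = p a], and taking adjoints gives [p a * p b = p a] as well.
    Transitivity is then associativity: [p a * c = p a * (p b * c) = p a * b = a].
    Antisymmetry is immediate, [a = p b * a = b]. The other relation is dual. *)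
Require Import Defs.
From mathcomp Require Import all_boot all_algebra.

Set Implicit Arguments.
Unset Strict Implicit.
Unset Printing Implicit Defensive.

Import GRing.Theory.
Local Open Scope ring_scope.

(** Writing the right factor of [star 1 * 1] as [star (star 1)] turns the product into
    [star (star 1 * 1)], which is 1. *)
Lemma star1 (R : involutionRingType) : star (1 : R) = 1.
Proof. by rewrite -[LHS]mulr1 -[X in _ * X]starK -starM mulr1 starK. Qed.

Lemma star0 (R : involutionRingType) : star (0 : R) = 0.
Proof. by apply: (@addrI _ (star 0)); rewrite -starD !addr0. Qed.

Lemma starN (R : involutionRingType) (x : R) : star (- x) = - star x.
Proof. by apply: (@addrI _ (star x)); rewrite -starD !subrr star0. Qed.

Lemma projection_compl (R : involutionRingType) (e : R) :
  projection e -> projection (1 - e).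
Proof.
case=> es ee; split; first by rewrite starD starN star1 -es.
by rewrite mulrBr mulr1 mulrBl mul1r -ee subrr subr0.
Qed.

(** Both [y * e = 0] and [y * (1 - e) = y] say that [y - y * e = y]. At [e := lproj a] this makes
    the support projection of [a] explicit. *)
Lemma lproj_projection (R : rickartStarRingType) (e : R) :
  projection e -> lproj e = 1 - e.
Proof.
move=> pe; apply: lproj_unique; first exact: projection_compl.
move=> y; rewrite mulrBr mulr1; split=> [->|ye]; first by rewrite subr0.
by apply/oppr_inj/(@addrI _ y); rewrite ye oppr0 addr0.
Qed.

Lemma rproj_projection (R : rickartStarRingType) (e : R) :
  projection e -> rproj e = 1 - e.
Proof.
move=> pe; apply: rproj_unique; first exact: projection_compl.
move=> z; rewrite mulrBl mul1r; split=> [->|ze]; first by rewrite subr0.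
by apply/oppr_inj/(@addrI _ z); rewrite ze oppr0 addr0.
Qed.

Lemma lproj2_projection (R : rickartStarRingType) (a : R) :
  projection (lproj (lproj a)).
Proof. by case: (lprojP (lproj a)). Qed.

Lemma rproj2_projection (R : rickartStarRingType) (a : R) :
  projection (rproj (rproj a)).
Proof. by case: (rprojP (rproj a)). Qed.

(** The right side, [y * (1 - lproj a) = 0], rearranges to [y * lproj a = y], the condition
    characterizing [lproj a]. *)
Lemma lproj2_annihilator (R : rickartStarRingType) (a y : R) :
  y * a = 0 <-> y * lproj (lproj a) = 0.
Proof.
have [pa aP] := lprojP a; rewrite lproj_projection // mulrBr mulr1.
split=> [/aP ->|/subr0_eq ya]; first by rewrite subrr.
exact/aP.
Qed.

Lemma rproj2_annihilator (R : rickartStarRingType) (a z : R) :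
  a * z = 0 <-> rproj (rproj a) * z = 0.
Proof.
have [pa aP] := rprojP a; rewrite rproj_projection // mulrBl mul1r.
split=> [/aP ->|/subr0_eq za]; first by rewrite subrr.
exact/aP.
Qed.

(** This is the annihilator equivalence applied to [y - 1]. *)
Lemma lproj2_fix (R : rickartStarRingType) (a y : R) :
  y * a = a <-> y * lproj (lproj a) = lproj (lproj a).
Proof.
have := lproj2_annihilator a (y - 1); rewrite !mulrBl !mul1r => -[h1 h2].
by split=> h; apply: subr0_eq; [apply: h1|apply: h2]; rewrite h subrr.
Qed.

Lemma rproj2_fix (R : rickartStarRingType) (a z : R) :
  a * z = a <-> rproj (rproj a) * z = rproj (rproj a).
Proof.
have := rproj2_annihilator a (z - 1); rewrite !mulrBr !mulr1 => -[h1 h2].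
by split=> h; apply: subr0_eq; [apply: h1|apply: h2]; rewrite h subrr.
Qed.

(** The involution reverses products and fixes [e] and [f], so the two identities are adjoints of
    each other. *)
Lemma projection_absorb (R : involutionRingType) (e f : R) :
  projection e -> projection f -> e * f = f <-> f * e = f.
Proof.
move=> [es _] [fs _].
by split=> /(congr1 (@star R)); rewrite starM -es -fs.
Qed.

Lemma left_star_le_order (R : rickartStarRingType) :
  partial_order (@left_star_le R).
Proof.
split=> [a|a b c [ab ba] [bc cb]|a b [_ ba] [ab _]]; last by rewrite ba.
  have aa : lproj (lproj a) * a = a.
    by apply/lproj2_fix; case: (lproj2_projection a).
  by split.
have pba := (lproj2_fix a _).1 (esym ba).
have pcb := (lproj2_fix b _).1 (esym cb).
have pab : lproj (lproj a) * lproj (lproj b) = lproj (lproj a).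
  by apply/projection_absorb => //; exact: lproj2_projection.
(* With [p x] for [lproj (lproj x)], the second condition is
   [p c * a = p c * p b * a = p b * a = a]. *)
by split; [rewrite -pab -mulrA bc|rewrite [in RHS]ba mulrA pcb].
Qed.

Lemma right_star_le_order (R : rickartStarRingType) :
  partial_order (@right_star_le R).
Proof.
split=> [a|a b c [ab ba] [bc cb]|a b [_ ba] [ab _]]; last by rewrite ba.
  have aa : a * rproj (rproj a) = a.
    by apply/rproj2_fix; case: (rproj2_projection a).
  by split.
have pab := (rproj2_fix a _).1 (esym ba).
have pbc := (rproj2_fix b _).1 (esym cb).
(* Multiplication is now on the right, so [pab] is the lifted identity and [pba] its adjoint. *)
have pba : rproj (rproj b) * rproj (rproj a) = rproj (rproj a).
  by apply/projection_absorb => //; exact: rproj2_projection.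
by split; [rewrite -pba mulrA bc|rewrite [in RHS]ba -mulrA pbc].
Qed.

Theorem theorem3p3 (R : rickartStarRingType) :
  partial_order (@left_star_le R) /\ partial_order (@right_star_le R).
Proof. by split; [exact: left_star_le_order|exact: right_star_le_order]. Qed.
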